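(* There exist absolute constants $c,C>0$ such that the following holds. Let $X_1,\dots,X_n$ be independent identically distributed real random variables, with common distribution that of a random variable $X$, and with $\mathbb{E}|X_1|<\infty$. Let $\ell$ be an integer with $1\le\ell\le n$ and let $M$ be the function whose conjugate $M^*$ is given by $$M^*\Big(\int_0^\beta X^*(z)\,dz\Big)=\frac{\beta}{\ell},\qquad 0\le\beta\le1,$$ and $M^*(s)=+\infty$ for $s>\mathbb{E}|X|$; that is, explicitly, $$M(s)=\int_0^s\int_{\{|X|\ge 1/(t\ell)\}}|X|\,d\mathbb{P}\,dt,\qquad s\ge0.$$ Then, for all $x\in\mathbb{R}^n$, $$c\,\|x\|_M\ \le\ \mathbb{E}\sum_{k=1}^{\ell}\operatorname*{k\text{-}max}_{1\le i\le n}|x_iX_i|\ \le\ C\,\|x\|_M.$$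
   Context: For real numbers $y_1,\dots,y_n$, $\operatorname{k-max}_{1\le i\le n}y_i$ is the $k$-th largest value among them (counted with multiplicity). $X^*(t)=\inf\{s\ge0:\mathbb{P}(|X|>s)\le t\}$ is the decreasing rearrangement of $X$. The conjugate of a function $N$ on $[0,\infty)$ is $N^*(x)=\sup_{t\ge0}(xt-N(t))$, and $M^{**}=M$. If $\beta\mapsto\int_0^\beta X^*$ takes a value several times (which only happens when $X^*$ vanishes on part of $[0,1]$), then the smallest such $\beta$ is used in the definition of $M^*$; the explicit formula for $M$ holds in all cases. $\|x\|_M=\inf\{\lambda>0:\sum_{i=1}^nM(|x_i|/\lambda)\le1\}$ is the Luxemburg norm on $\mathbb{R}^n$. *)

(* Defs.v *)
From mathcomp Require Import all_boot all_order all_algebra.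
From mathcomp Require Import all_classical all_reals all_analysis.
Set Implicit Arguments.
Unset Strict Implicit.
Unset Printing Implicit Defensive.
Import Order.TTheory GRing.Theory Num.Theory.
Import numFieldNormedType.Exports.
Local Open Scope classical_set_scope.
Local Open Scope ring_scope.

Definition mutually_independent (R : realType) (d : measure_display)
    (T : measurableType d) (P : probability T R) (n : nat)
    (X : 'I_n -> {RV P >-> R}) : Prop :=
  forall (J : {set 'I_n}) (A : 'I_n -> set R),
    (forall i, measurable (A i)) ->
    P [set w | forall i, i \in J -> A i (X i w)] =
    (\prod_(i in J) P [set w | A i (X i w)])%E.

Definition identically_distributed (R : realType) (d : measure_display)
    (T : measurableType d) (P : probability T R) (X Y : {RV P >-> R}) : Prop :=
  forall A : set R, measurable A -> distribution P X A = distribution P Y A.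

(* Ranks are counted from 1: [kmax 1 y] is the maximum and [kmax n y] the
   minimum of the n values of y. *)
Definition kmax (R : realType) (n k : nat) (y : 'I_n -> R) : R :=
  nth 0 (sort (fun a b : R => b <= a) (codom y)) k.-1.

(* Extended-real valued: the value at 0 is +oo when X is unbounded. *)
Definition rearrangement (R : realType) (d : measure_display)
    (T : measurableType d) (P : probability T R) (X : T -> R) (t : R) : \bar R :=
  ereal_inf [set s%:E | s in
    [set s : R | 0 <= s /\ (P [set w | (s < `|X w|)%R] <= t%:E)%E]].

(* Functions on [0, +oo[ are represented by functions on R whose values at
   negative arguments are never used. *)
Definition conjugate (R : realType) (N : R -> \bar R) (x : R) : \bar R :=
  ereal_sup [set ((x * t)%:E - N t)%E | t in [set t : R | 0 <= t]].

(* M^* maps \int_0^b X^* to b / l, where b is the smallest point of [0, 1]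
   at which the value is attained; it is +oo beyond E|X|. *)
Definition Mstar (R : realType) (d : measure_display) (T : measurableType d)
    (P : probability T R) (X : T -> R) (l : nat) (s : R) : \bar R :=
  if ('E_P[fun w => `|X w|%R] < s%:E)%E then +oo%E else
  ereal_inf [set (b / l%:R)%:E | b in
    [set b : R | 0 <= b <= 1 /\
      (\int[lebesgue_measure]_(z in `[0%R, b]) rearrangement P X z)%E = s%:E]].

Definition Mfun (R : realType) (d : measure_display) (T : measurableType d)
    (P : probability T R) (X : T -> R) (l : nat) : R -> \bar R :=
  conjugate (Mstar P X l).

(* The outer integral excludes t = 0, where 1 / (t * l) would denote 0. *)
Definition Mexplicit (R : realType) (d : measure_display)
    (T : measurableType d) (P : probability T R) (X : T -> R) (l : nat)
    (s : R) : \bar R :=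
  (\int[lebesgue_measure]_(t in `]0%R, s])
     \int[P]_(w in [set w | (1 / (t * l%:R) <= `|X w|)%R]) (`|X w|%R)%:E)%E.

Definition luxemburg_norm (R : realType) (n : nat) (N : R -> \bar R)
    (x : 'rV[R]_n) : \bar R :=
  ereal_inf [set r%:E | r in
    [set r : R | 0 < r /\ (\sum_(i < n) N (`|x ord0 i| / r)%R <= 1)%E]].

(* Main.v *)
(** Put [M s = E (s|X| - 1/l)_+]; this is both the conjugate of [M^*] and the
    explicit double integral. For the first, the rearrangement satisfies
    [int_0^b X^* <= a b + E (|X| - a)_+], with equality when [X^*] crosses the
    level [a] at [b], which is Young's (in)equality for [M] and [M^*]; for the
    second, exchange the integrals.

    For nonnegative reals, the sum [S] of the [l] largest [y_i] is the minimum
    over [t] of [l t + sum_i (y_i - t)_+], attained at the [l]-th largest value.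
    With [y_i = |x_i X_i|] and [t = r / l], the inequality [||x||_M <= r] reads
    [sum_i E (y_i - t)_+ <= r], which bounds [E S] by [2 r]. Conversely, let [N]
    be the number of [y_i > t] and suppose [sum_i E (y_i - t)_+ > r]. If
    [E N > l/2], then [S >= t min (N, l)] and a second moment bound yield
    [E S >= 5 r / 16]. If [E N <= l/2], then [S >= sum_i (y_i - t)_+ (1 - N_i/l)],
    where [N_i] counts the indices other than [i], and independence yields
    [E S >= r / 2]. *)
Require Import Defs.
From mathcomp Require Import all_boot all_order all_algebra.
From mathcomp Require Import all_classical all_reals all_analysis.
From mathcomp Require Import measurable_realfun measurable_fun_approximation.
From mathcomp Require Import ring lra.
Import Order.TTheory GRing.Theory Num.Theory.
Import numFieldNormedType.Exports.
Local Open Scope classical_set_scope.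
Local Open Scope ring_scope.

Set Implicit Arguments.
Unset Strict Implicit.
Unset Printing Implicit Defensive.

(** * Deterministic bounds for the sum of the [l] largest values *)

Lemma sum_kmax_nat (R : realType) (n l : nat) (y : 'I_n -> R) :
  \sum_(1 <= k < l.+1) kmax k y =
  \sum_(0 <= k < l) nth 0 (sort (fun a b : R => b <= a) (codom y)) k.
Proof. by rewrite big_add1. Qed.

Lemma sum_sort_codom (R : realType) (n : nat) (y : 'I_n -> R) (g : R -> R) :
  \sum_(i < n) g (y i) =
  \sum_(0 <= k < n) g (nth 0 (sort (fun a b : R => b <= a) (codom y)) k).
Proof.
set s := sort _ _.
have ss : size s = n by rewrite size_sort size_codom card_ord.
have -> : \sum_(i < n) g (y i) = \sum_(v <- codom y) g v.
  by rewrite big_map enumT.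
rewrite (perm_big s); last by rewrite perm_sym perm_sort.
by rewrite (big_nth 0) ss.
Qed.

(** In sorted order, each of the first [l] values is at most [t] plus its excess over [t]; the
    remaining excesses are nonnegative. *)
Lemma sum_kmax_le (R : realType) (n l : nat) (y : 'I_n -> R) (t : R) :
  (l <= n)%N ->
  \sum_(1 <= k < l.+1) kmax k y <= t *+ l + \sum_(i < n) Num.max (y i - t) 0.
Proof.
move=> ln; rewrite sum_kmax_nat (sum_sort_codom y (fun v => Num.max (v - t) 0)).
set s := sort _ _.
rewrite (big_cat_nat (leq0n l) ln)/= addrA -[leLHS]addr0 lerD//; last first.
  by apply: sumr_ge0 => i _; rewrite le_max lexx orbT.
rewrite -[X in t *+ X]subn0 -sumr_const_nat -big_split/= ler_sum// => i _.
by rewrite -lerBlDl le_max lexx.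
Qed.

Lemma sum_kmax_attained (R : realType) (n l : nat) (y : 'I_n -> R) :
  (1 <= l <= n)%N ->
  exists j, \sum_(1 <= k < l.+1) kmax k y =
    y j *+ l + \sum_(i < n) Num.max (y i - y j) 0.
Proof.
move=> /andP[l0 ln]; pose ge (a b : R) := b <= a.
pose s := sort ge (codom y).
have ss : size s = n by rewrite size_sort size_codom card_ord.
have ln' : (l.-1 < n)%N by rewrite prednK.
have /codomP[j jE] : nth 0 s l.-1 \in codom y.
  by rewrite -(mem_sort ge) mem_nth// -/s ss.
(* [y j] is the value at sorted position [l - 1]: the first [l] values are at least [y j], and the
   later ones have no excess over it. *)
exists j; rewrite -jE sum_kmax_nat.
rewrite (sum_sort_codom y (fun v => Num.max (v - nth 0 s l.-1) 0)) -/ge -/s.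
have gt : transitive ge by move=> a b c ab bc; exact: le_trans bc ab.
have gr : reflexive ge by move=> a; exact: lexx.
have srt : sorted ge s by apply: sort_sorted => a b; rewrite /ge orbC le_total.
have mono i k : (i <= k < n)%N -> nth 0 s k <= nth 0 s i.
  move=> /andP[ik kn].
  by apply: (sorted_leq_nth gt gr 0 srt) => //; rewrite inE ss// (leq_ltn_trans ik).
rewrite (big_cat_nat (leq0n l) ln)/= [X in _ + (_ + X)]big_nat.
rewrite [X in _ + (_ + X)]big1; last first.
  move=> i /andP[li iN]; apply/max_idPr; rewrite subr_le0 mono// iN andbT.
  by rewrite (leq_trans _ li)// leq_pred.
rewrite addr0 -[X in _ *+ X]subn0 -sumr_const_nat -big_split/= !big_nat.
apply: eq_bigr => i /andP[_ il].
have h : nth 0 s l.-1 <= nth 0 s i by rewrite mono// ln' andbT -ltnS prednK.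
by rewrite max_l ?subr_ge0// addrC subrK.
Qed.

(** Let [y j] be the [l]-th largest value. If [t <= y j], the term [l * y j] suffices. Otherwise
    each value above [t] has excess at least [t - y j] over [y j], which covers the second part of
    [t q = y j * q + (t - y j) * q]. A real [q] allows a quadratic in the count. *)
Lemma sum_kmax_ge_min (R : realType) (n l : nat) (y : 'I_n -> R) (t q : R) :
  (1 <= l <= n)%N -> (forall i, 0 <= y i) -> 0 <= t ->
  q <= l%:R -> q <= \sum_(i < n) (t < y i)%R%:R ->
  t * q <= \sum_(1 <= k < l.+1) kmax k y.
Proof.
move=> ln y0 t0 ql qN; have [j ->] := sum_kmax_attained y ln.
have [tj|jt] := leP t (y j).
  rewrite -[leLHS]addr0 lerD ?sumr_ge0// => [|i _]; last by rewrite le_max lexx orbT.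
  rewrite -mulr_natr; apply: (@le_trans _ _ (t * l%:R)).
    by rewrite ler_wpM2l.
  by rewrite ler_wpM2r.
have -> : t * q = y j * q + (t - y j) * q by ring.
rewrite lerD -?[leRHS]mulr_natr ?ler_wpM2l//.
apply: (@le_trans _ _ ((t - y j) * \sum_(i < n) (t < y i)%R%:R)).
  by rewrite ler_wpM2l// subr_ge0 ltW.
rewrite mulr_sumr ler_sum// => i _; case: ltP => ti.
  by rewrite mulr1 le_max lerD2r ltW.
by rewrite mulr0 le_max lexx orbT.
Qed.

(* The concave quadratic [q - q^2 / (4 l)], q = th * N, lies below
   [min (q, l)], and its expectation only involves pairs of indices. *)
Lemma sum_kmax_ge_count (R : realType) (n l : nat) (y : 'I_n -> R) (t th : R) :
  (1 <= l <= n)%N -> (forall i, 0 <= y i) -> 0 <= t -> 0 <= th <= 1 ->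
  t * th * (\sum_(i < n) (t < y i)%R%:R) <=
  \sum_(1 <= k < l.+1) kmax k y + t * th ^+ 2 / (4 * l%:R) *
    (\sum_(i < n) (t < y i)%R%:R +
     \sum_(i < n) \sum_(j < n | j != i) (t < y i)%R%:R * (t < y j)%R%:R).
Proof.
move=> ln y0 t0 /andP[th0 th1]; set N := \sum_(i < n) (t < y i)%R%:R.
have lgt : (0 : R) < l%:R by rewrite ltr0n; case/andP: ln.
have N0 : 0 <= N by apply: sumr_ge0.
(* The diagonal pairs of [N ^+ 2] contribute [N], since indicators are idempotent. *)
have -> : N + \sum_(i < n) \sum_(j < n | j != i) (t < y i)%R%:R * (t < y j)%R%:R
    = N ^+ 2.
  rewrite expr2 {2}/N mulr_suml -big_split/=; apply: eq_bigr => i _.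
  rewrite -mulr_sumr /N [in RHS](bigD1 i)//= mulrDr; congr (_ + _).
  by case: (t < y i); rewrite /= ?mulr1 ?mulr0.
rewrite -lerBlDr.
have -> : t * th * N - t * th ^+ 2 / (4 * l%:R) * N ^+ 2 =
    t * (th * N - (th * N) ^+ 2 / (4 * l%:R)) by ring.
apply: sum_kmax_ge_min => //.
  (* The difference is a perfect square: [q - q^2 / (4 l)] peaks at the value [l], for [q = 2 l]. *)
  rewrite -subr_ge0.
  have -> : l%:R - (th * N - (th * N) ^+ 2 / (4 * l%:R)) =
      (th * N - 2 * l%:R) ^+ 2 / (4 * l%:R) by field; lra.
  by rewrite divr_ge0 ?sqr_ge0// mulr_ge0// ltW.
rewrite -/N lerBlDr; apply: (@le_trans _ _ N); first by rewrite ler_piMl.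
by rewrite lerDl divr_ge0 ?sqr_ge0// mulr_ge0// ltW.
Qed.

(** If at most [l] values exceed [t], the sum of the [l] largest already dominates the excesses. If
    more do, every [i] with [y i > t] has at least [l] other indices above [t], so the correction
    term alone dominates. *)
Lemma sum_kmax_ge_excess (R : realType) (n l : nat) (y : 'I_n -> R) (t : R) :
  (1 <= l <= n)%N -> (forall i, 0 <= y i) -> 0 <= t ->
  \sum_(i < n) Num.max (y i - t) 0 <= \sum_(1 <= k < l.+1) kmax k y +
    l%:R^-1 * \sum_(i < n) \sum_(j < n | j != i)
                Num.max (y i - t) 0 * (t < y j)%R%:R.
Proof.
move=> ln y0 t0.
have lgt : (0 : R) < l%:R by rewrite ltr0n; case/andP: ln.
pose N := (\sum_(i < n) (t < y i)%R)%N.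
have NE : (N%:R : R) = \sum_(i < n) (t < y i)%R%:R.
  by rewrite /N natr_sum.
have f0 i : 0 <= Num.max (y i - t) 0 by rewrite le_max lexx orbT.
have [Nl|lN] := leqP N l.
  rewrite -[leLHS]addr0 lerD//; last first.
    apply: mulr_ge0; first by rewrite invr_ge0 ltW.
    by apply: sumr_ge0 => i _; apply: sumr_ge0 => j _; rewrite mulr_ge0.
  have [j ->] := sum_kmax_attained y ln.
  have [jt|tj] := leP (y j) t.
    rewrite -[leLHS]add0r lerD ?mulrn_wge0// ler_sum// => i _.
    by rewrite ge_max !le_max lexx orbT andbT lerD2l lerN2 jt.
  apply: (@le_trans _ _ ((y j - t) * N%:R + \sum_(i < n) Num.max (y i - y j) 0)).
    rewrite NE mulr_sumr -big_split ler_sum//= => i _.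
    case: (ltP t (y i)) => ti; rewrite ?mulr1 ?mulr0 /Num.max;
      by do 2 (case: ltP => ?); lra.
  rewrite lerD2r -[leRHS]mulr_natr; apply: (@le_trans _ _ (y j * N%:R)).
    by rewrite ler_wpM2r// gerBl.
  by rewrite ler_wpM2l// ler_nat.
rewrite -[leLHS]add0r lerD//.
  by have := @sum_kmax_ge_min R n l y t 0 ln y0 t0 (ltW lgt);
     rewrite mulr0; apply; apply: sumr_ge0.
rewrite mulr_sumr ler_sum// => i _; case: (ltP t (y i)) => ti.
  rewrite -mulr_sumr mulrCA ler_peMr// mulrC ler_pdivlMr// mul1r.
  rewrite -(lerD2l 1) -[1 + \sum_(_ | _) _](_ : N%:R = _); last first.
    by rewrite NE (bigD1 i)//= ti.
  by rewrite nat1r ler_nat.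
rewrite (max_idPr _) ?subr_le0//.
apply: mulr_ge0; first by rewrite invr_ge0 ltW.
by apply: sumr_ge0 => j _; rewrite mul0r.
Qed.

(** * Layer cake formula and independence *)

Lemma ge0_integral_layer_cake (R : realType) (d : measure_display)
    (T : measurableType d) (mu : {sigma_finite_measure set T -> \bar R})
    (f : T -> \bar R) : measurable_fun setT f -> (forall x, (0 <= f x)%E) ->
  (\int[mu]_x f x =
   \int[lebesgue_measure]_(u in `[0%R, +oo[) mu [set x | u%:E < f x])%E.
Proof.
move=> mf f0.
(* Tonelli on the region under the graph of [f]. *)
pose A := [set p : T * measurableTypeR R | 0 <= p.2 /\ (p.2%:E < f p.1)%E].
have mA : measurable A.
  rewrite (_ : A = (fun p : T * measurableTypeR R => 0 <= p.2) @^-1` [set true]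
      `&` (fun p : T * measurableTypeR R => (p.2%:E < f p.1)%E) @^-1` [set true]).
    apply: measurableI; rewrite -[X in measurable X]setTI.
      by apply: measurable_fun_ler.
    apply: measurable_fun_lte => //.
      by apply: measurableT_comp.
    by apply: measurableT_comp => //; exact: measurable_fst.
  by apply/seteqP; split => p /=.
transitivity (\int[mu]_x \int[lebesgue_measure]_u
    (\1_A (x, u))%:E)%E.
  apply: eq_integral => x _.
  transitivity (\int[lebesgue_measure]_u
      (\1_[set u : R | 0 <= u /\ (u%:E < f x)%E] u)%:E)%E => //.
  have := f0 x; case: (f x) => [r r0| _|//].
    have -> : [set u : R | 0 <= u /\ (u%:E < r%:E)%E] = `[0, r[%classic.
      by apply/seteqP; split=> u/=; rewrite in_itv/= lte_fin => /andP.
    rewrite integral_indic// setIT. rewrite /= lebesgue_measure_itv/= lte_fin.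
    move: r0; rewrite lee_fin le_eqVlt => /predU1P[<-|->]; first by rewrite ltxx.
    by rewrite sube0.
  have -> : [set u : R | 0 <= u /\ (u%:E < +oo)%E] = `[0, +oo[%classic.
    by apply/seteqP; split=> u/=; rewrite in_itv/= andbT ltry => // -[].
  by rewrite integral_indic// setIT /= lebesgue_measure_itv/= ltry.
rewrite (fubini_tonelli (fun p => (\1_A p)%:E))//=; last first.
  exact/measurable_EFinP/measurable_indic.
rewrite [RHS]integral_mkcond; apply: eq_integral => u _.
rewrite patchE; have [|] := boolP (u \in `[0, +oo[%classic) => u0.
  rewrite (_ : (fun x => _) = (fun x => (\1_[set x | (u%:E < f x)%E] x)%:E)).
    rewrite integral_indic ?setIT//.
    by have := @emeasurable_fun_o_infty _ _ _ _ _ measurableT mf u%:E; rewrite setTI.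
  move: u0; rewrite inE/= in_itv/= andbT => u0.
  apply/funext => x; rewrite !indicE/=; congr ((nat_of_bool _)%:R%:E).
  by apply/idP/idP; rewrite !inE; [case|split].
apply: integral0_eq => x _; rewrite indicE memNset//=.
move: u0; rewrite notin_setE/= in_itv/= andbT => u0 -[].
by move/u0.
Qed.

Lemma measurable_tail (R : realType) (d : measure_display)
    (T : measurableType d) (P : probability T R) (f : T -> \bar R) :
  measurable_fun setT f ->
  measurable_fun setT (fun u : R => P [set x | (u%:E < f x)%E]).
Proof.
move=> mf; have mu u : measurable [set x | (u%:E < f x)%E].
  by rewrite -[X in measurable X]setTI; exact: emeasurable_fun_o_infty.
rewrite (_ : (fun u : R => _) = EFin \o (fun u => fine (P [set x | (u%:E < f x)%E]))).
  apply/measurable_EFinP; apply: nonincreasing_measurable => // u v uv.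
  apply: fine_le; rewrite ?fin_num_measure// le_measure ?inE// => w /=.
  by apply: le_lt_trans; rewrite lee_fin.
by apply/funext => u /=; rewrite fineK// fin_num_measure.
Qed.

(** The layer cake formula replaces [f] by indicators of its superlevel sets, to which the product
    rule for the pair [i], [j] applies. *)
Lemma integral_independent (R : realType) (d : measure_display)
    (T : measurableType d) (P : probability T R) (n : nat)
    (X : 'I_n -> {RV P >-> R}) (i j : 'I_n) (f : R -> R) (B : set R) :
  mutually_independent X -> i != j -> measurable_fun setT f ->
  (forall x, 0 <= f x) -> measurable B ->
  (\int[P]_w (f (X i w) * \1_B (X j w))%:E =
   (\int[P]_w (f (X i w))%:E) * P (X j @^-1` B))%E.
Proof.
move=> ind ij mf f0 mB.
have mfi : measurable_fun setT (f \o X i) by exact: measurableT_comp.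
have mBj : measurable_fun setT (\1_B \o X j : T -> R).
  by apply: measurableT_comp => //; exact: measurable_indic.
rewrite ge0_integral_layer_cake; last 2 first.
- exact/measurable_EFinP/measurable_funM.
- by move=> w; rewrite lee_fin mulr_ge0.
rewrite [X in (X * _)%E]ge0_integral_layer_cake; last 2 first.
- exact/measurable_EFinP.
- by move=> w; rewrite lee_fin.
rewrite -ge0_integralZr//; last first.
  by apply: measurable_funTS; apply: measurable_tail; exact/measurable_EFinP.
apply: eq_integral => u; rewrite inE/= in_itv/= andbT => u0.
(* Only the sets at [i] and [j] enter the product over the pair, so [B] can stand at every index
   other than [i]. *)
pose A k := if k == i then f @^-1` `]u, +oo[ else B.
have mfu : measurable (f @^-1` `]u, +oo[).
  by rewrite -[X in measurable X]setTI; exact: mf.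
have mA k : measurable (A k) by rewrite /A; case: ifP.
have := ind [set i; j]%SET A mA.
have -> : (\prod_(k in [set i; j]%SET) P [set w | A k (X k w)] =
    P [set w | A i (X i w)] * P [set w | A j (X j w)])%E.
  rewrite (bigD1 i) ?inE ?eqxx//=; congr (_ * _)%E; apply: big_pred1 => k.
  by rewrite !inE; case: (eqVneq k i) => [->|]; rewrite ?andbF ?andbT// (negbTE ij).
have -> : A i = f @^-1` `]u, +oo[ by rewrite /A eqxx.
have Aj : A j = B by rewrite /A eq_sym (negbTE ij).
rewrite Aj => indu.
transitivity (P [set w | forall k, k \in [set i; j]%SET -> A k (X k w)]).
  congr (P _); apply/seteqP; split => w /=; rewrite indicE lte_fin.
    case: (boolP (X j w \in B)) => [|_]; last first.
      by rewrite mulr0 ltNge u0.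
    rewrite inE mulr1 => Bj ui k; rewrite !inE => /orP[/eqP ->|/eqP ->].
      by rewrite /A eqxx/= in_itv/= ui.
    by rewrite Aj.
  move=> h; have := h i; have := h j; rewrite !inE !eqxx orbT Aj => /(_ isT) Bj.
  by rewrite /A eqxx/= in_itv/= andbT mem_set// mulr1 => /(_ isT).
rewrite indu; congr (P _ * P _)%E.
by apply/seteqP; split => w /=; rewrite in_itv/= andbT lte_fin.
Qed.

(** * Expectation of the sum of the largest values *)

Lemma measurable_sum_kmax (R : realType) (d : measure_display)
    (T : measurableType d) (n l : nat) (y : 'I_n -> T -> R) :
  (1 <= l <= n)%N -> (forall i, measurable_fun setT (y i)) ->
  measurable_fun setT
    (fun w => \sum_(1 <= k < l.+1) kmax k (fun i => y i w)).
Proof.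
(* By [sum_kmax_le] and [sum_kmax_attained] the sum is the minimum over [j] of [G j], a finite
   minimum of measurable functions in which no sorting appears. *)
move=> ln my; pose G j w := y j w *+ l + \sum_(i < n) Num.max (y i w - y j w) 0.
have mG j : measurable_fun setT (G j).
  apply: measurable_funD.
    rewrite [X in measurable_fun _ X](_ : _ = (fun w => y j w * l%:R)); last first.
      by apply/funext => w; rewrite mulr_natr.
    exact: measurable_funM.
  apply: measurable_sum => i; apply: measurable_maxr => //.
  by apply: measurable_funB.
have n0 : (0 < n)%N by case/andP: ln; exact: leq_trans.
pose j0 := Ordinal n0.
rewrite [X in measurable_fun _ X](_ : _ =
    (fun w => \big[Num.min/G j0 w]_(j <- index_enum 'I_n) G j w)).
  elim: (index_enum _) => [|a s ih]; last first.
    rewrite [X in measurable_fun _ X](_ : _ = G a \min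
      (fun w => \big[Num.min/G j0 w]_(j <- s) G j w)); first exact: measurable_minr.
    by apply/funext => w; rewrite big_cons.
  rewrite [X in measurable_fun _ X](_ : _ = G j0)//.
  by apply/funext => w; rewrite big_nil.
apply/funext => w; apply/eqP; rewrite eq_le; apply/andP; split.
  have lnn : (l <= n)%N by case/andP: ln.
  by apply: le_bigmin => [|j _]; exact: sum_kmax_le.
by have [j ->] := sum_kmax_attained (y^~ w) ln; exact: bigmin_le.
Qed.

Lemma expectation_sum_kmax_le (R : realType) (d : measure_display)
    (T : measurableType d) (P : probability T R) (n l : nat)
    (y : 'I_n -> T -> R) (t : R) :
  (1 <= l <= n)%N -> (forall i, measurable_fun setT (y i)) ->
  (forall i w, 0 <= y i w) -> 0 <= t ->
  (\int[P]_w (\sum_(1 <= k < l.+1) kmax k (fun i => y i w))%:E <=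
   (t *+ l)%:E + \sum_(i < n) \int[P]_w (Num.max (y i w - t) 0)%:E)%E.
Proof.
move=> ln my y0 t0.
have mf i : measurable_fun setT (fun w => (Num.max (y i w - t) 0)%:E).
  apply/measurable_EFinP; by apply: measurable_maxr => //; apply: measurable_funB.
have f0 i w : (0 <= (Num.max (y i w - t) 0)%:E)%E.
  by rewrite lee_fin le_max lexx orbT.
rewrite -ge0_integral_sum//.
have <- : (\int[P]_w (t *+ l)%:E = (t *+ l)%:E)%E.
  by rewrite integral_cst//= probability_setT mule1.
rewrite -ge0_integralD//; last 3 first.
- by move=> w _; rewrite lee_fin mulrn_wge0.
- by move=> w _; apply: sume_ge0.
- by apply: emeasurable_sum.
apply: ge0_le_integral => //.
(* Nonnegativity of the sum is the count bound with [t = q = 0]. *)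
- move=> w _; rewrite lee_fin; have := @sum_kmax_ge_min R n l (y^~ w) 0 0 ln.
  by rewrite mul0r; apply => //; apply: sumr_ge0.
- by apply/measurable_EFinP; exact: measurable_sum_kmax.
- by apply: emeasurable_funD => //; apply: emeasurable_sum.
- move=> w _; rewrite sumEFin -EFinD lee_fin; apply: sum_kmax_le.
  by case/andP: ln.
Qed.

Lemma ge0_integral_EFin_sum (R : realType) (d : measure_display)
    (T : measurableType d) (mu : {measure set T -> \bar R}) (I : eqType)
    (r : seq I) (Q : pred I) (f : I -> T -> R) (v : I -> R) :
  (forall i, measurable_fun setT (f i)) -> (forall i w, 0 <= f i w) ->
  (forall i, Q i -> \int[mu]_w (f i w)%:E = (v i)%:E)%E ->
  (\int[mu]_w (\sum_(i <- r | Q i) f i w)%:E =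
   (\sum_(i <- r | Q i) v i)%:E)%E.
Proof.
move=> mf f0 fv; rewrite -big_filter -sumEFin.
under eq_integral do rewrite -big_filter -sumEFin.
rewrite ge0_integral_sum//.
- by apply: eq_big_seq => i; rewrite mem_filter => /andP[/fv].
- by move=> i; exact/measurable_EFinP.
- by move=> i w _; rewrite lee_fin.
Qed.

(** Carries a pointwise inequality over to real-valued expectations, so that the estimates below end
    in real arithmetic. *)
Lemma ge0_le_integralD_EFin (R : realType) (d : measure_display)
    (T : measurableType d) (mu : {measure set T -> \bar R})
    (f g h : T -> R) (k a b c : R) :
  measurable_fun setT f -> measurable_fun setT g -> measurable_fun setT h ->
  (forall w, 0 <= f w) -> (forall w, 0 <= g w) -> (forall w, 0 <= h w) ->
  0 <= k ->
  (\int[mu]_w (f w)%:E = a%:E)%E -> (\int[mu]_w (g w)%:E = b%:E)%E ->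
  (\int[mu]_w (h w)%:E = c%:E)%E ->
  (forall w, f w <= g w + k * h w) -> a <= b + k * c.
Proof.
move=> /measurable_EFinP mf /measurable_EFinP mg mh f0 g0 h0 k0 fa gb hc fgh.
have mkh : measurable_fun setT (EFin \o (fun w => k * h w)).
  by apply/measurable_EFinP; exact: measurable_funM.
rewrite -lee_fin -fa EFinD EFinM -gb -hc -ge0_integralZl_EFin//; last 2 first.
- by move=> w _; rewrite lee_fin.
- exact/measurable_EFinP.
rewrite -ge0_integralD//; last 2 first.
- by move=> w _; rewrite lee_fin.
- by move=> w _; rewrite lee_fin mulr_ge0.
apply: ge0_le_integral => //.
- by move=> w _; rewrite lee_fin.
- exact: emeasurable_funD.
- by move=> w _; rewrite -EFinM -EFinD lee_fin.
Qed.

Lemma measurable_sum_cond (R : realType) (d : measure_display)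
    (T : measurableType d) (D : set T) (I : Type) (r : seq I) (Q : pred I)
    (f : I -> T -> R) :
  (forall i, measurable_fun D (f i)) ->
  measurable_fun D (fun w => \sum_(i <- r | Q i) f i w).
Proof.
move=> mf; rewrite [X in measurable_fun _ X](_ : _ =
  (fun w => \sum_(i <- [seq i <- r | Q i]) f i w)); first exact: measurable_sum.
by apply/funext => w; rewrite big_filter.
Qed.

(** The converse estimate with [r = l * t]. Independence enters through the products for pairs
    [i != j]. The two cases on the expected count [m] give the factors [1/2] and [5/16], both above
    [1/4]. *)
Lemma expectation_sum_kmax_ge (R : realType) (d : measure_display)
    (T : measurableType d) (P : probability T R) (n l : nat)
    (y : 'I_n -> T -> R) (t : R) (e p : 'I_n -> R) :
  (1 <= l <= n)%N -> (forall i, measurable_fun setT (y i)) ->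
  (forall i w, 0 <= y i w) -> 0 <= t ->
  (forall i, \int[P]_w (Num.max (y i w - t) 0)%:E = (e i)%:E)%E ->
  (forall i, \int[P]_w ((t < y i w)%R%:R)%:E = (p i)%:E)%E ->
  (forall i j, i != j ->
    \int[P]_w ((t < y i w)%R%:R * (t < y j w)%R%:R)%:E = (p i * p j)%:E)%E ->
  (forall i j, i != j ->
    \int[P]_w (Num.max (y i w - t) 0 * (t < y j w)%R%:R)%:E =
    (e i * p j)%:E)%E ->
  l%:R * t <= \sum_(i < n) e i ->
  ((l%:R * t / 4)%:E <=
   \int[P]_w (\sum_(1 <= k < l.+1) kmax k (fun i => y i w))%:E)%E.
Proof.
move=> ln my y0 t0 eE pE ppE epE lte.
have l1 : (1 : R) <= l%:R by rewrite ler1n; case/andP: ln.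
have mS := measurable_sum_kmax ln my.
have S0 w : 0 <= \sum_(1 <= k < l.+1) kmax k (y^~ w).
  have := @sum_kmax_ge_min R n l (y^~ w) 0 0 ln.
  by rewrite mul0r; apply => //; apply: sumr_ge0.
have mf i : measurable_fun setT (fun w => Num.max (y i w - t) 0).
  by apply: measurable_maxr => //; apply: measurable_funB.
have f0 i w : 0 <= Num.max (y i w - t) 0 by rewrite le_max lexx orbT.
have m1 i : measurable_fun setT (fun w => (t < y i w)%R%:R : R).
  rewrite [X in measurable_fun _ X](_ : _ = (fun w => if t < y i w then 1 else 0)).
    by apply: measurable_fun_if => //; exact: measurable_fun_ltr.
  by apply/funext => w; case: ifP.
have e0 i : 0 <= e i by rewrite -lee_fin -eE; apply: integral_ge0 => w _; rewrite lee_fin.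
have p0 i : 0 <= p i by rewrite -lee_fin -pE; apply: integral_ge0 => w _; rewrite lee_fin.
(* An infinite expectation makes the bound trivial; otherwise it is a real number [s]. *)
case SE : (\int[P]_w (\sum_(1 <= k < l.+1) kmax k (fun i => y i w))%:E)%E
  => [s| |]; last 2 first.
- by rewrite leey.
- suff : (0 <= -oo :> \bar R)%E by [].
  by rewrite -SE; apply: integral_ge0 => w _; rewrite lee_fin.
rewrite lee_fin; pose m := \sum_(i < n) p i.
have m0 : 0 <= m by apply: sumr_ge0.
(* Adding the nonnegative diagonal terms turns the double sum into a product. *)
have sumD (a : 'I_n -> R) : (forall i, 0 <= a i) ->
    \sum_(i < n) \sum_(j < n | j != i) a i * p j <= (\sum_(i < n) a i) * m.
  move=> a0; rewrite mulr_suml ler_sum// => i _; rewrite -mulr_sumr ler_wpM2l//.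
  by rewrite /m [leRHS](bigD1 i)//= lerDr.
have pairE (a : 'I_n -> R) (f : 'I_n -> T -> R) :
    (forall i, measurable_fun setT (f i)) -> (forall i w, 0 <= f i w) ->
    (forall i j, i != j -> \int[P]_w (f i w * (t < y j w)%R%:R)%:E =
      (a i * p j)%:E)%E ->
    [/\ measurable_fun setT (fun w => \sum_(i < n) \sum_(j < n | j != i)
            f i w * (t < y j w)%R%:R),
        forall w, 0 <= \sum_(i < n) \sum_(j < n | j != i)
            f i w * (t < y j w)%R%:R &
        (\int[P]_w (\sum_(i < n) \sum_(j < n | j != i)
            f i w * (t < y j w)%R%:R)%:E =
         (\sum_(i < n) \sum_(j < n | j != i) a i * p j)%:E)%E].
  move=> mfi fi0 fE.
  have mij i j : measurable_fun setT (fun w => f i w * (t < y j w)%R%:R).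
    exact: measurable_funM.
  have mi i : measurable_fun setT
      (fun w => \sum_(j < n | j != i) f i w * (t < y j w)%R%:R).
    exact: measurable_sum_cond.
  have ij0 i j w : 0 <= f i w * (t < y j w)%R%:R by rewrite mulr_ge0.
  have i0 i w : 0 <= \sum_(j < n | j != i) f i w * (t < y j w)%R%:R.
    exact: sumr_ge0.
  split; [exact: measurable_sum|by move=> w; exact: sumr_ge0|].
  apply: ge0_integral_EFin_sum => // i _; apply: ge0_integral_EFin_sum => // j ji.
  by rewrite fE// eq_sym.
(* If [m <= l / 2], the correction term is at most half of the total expected excess, so [s] is at
   least the other half. *)
have [ml|lm] := leP m (l%:R / 2).
  have [mef ef0 efE] := pairE e _ mf f0 epE.
  have : \sum_(i < n) e i <=
      s + l%:R^-1 * (\sum_(i < n) \sum_(j < n | j != i) e i * p j).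
    apply: (ge0_le_integralD_EFin (mu := P)
      (f := fun w => \sum_(i < n) Num.max (y i w - t) 0) _ mS mef _ S0 ef0 _ _ SE efE).
    + exact: measurable_sum.
    + by move=> w; apply: sumr_ge0.
    + by rewrite invr_ge0.
    + exact: ge0_integral_EFin_sum.
    + by move=> w; exact: sum_kmax_ge_excess.
  have E0 : 0 <= \sum_(i < n) e i by apply: sumr_ge0.
  have : l%:R^-1 * (\sum_(i < n) \sum_(j < n | j != i) e i * p j) <=
      (\sum_(i < n) e i) / 2.
    rewrite ler_pdivrMl ?(lt_le_trans _ l1)//.
    apply: (le_trans (sumD _ e0)); rewrite mulrCA ler_wpM2l//.
  lra.
have [m11 n110 n11E] := pairE p _ m1 (fun i w => ler0n _ _) ppE.
have mgt : 0 < m by apply: le_lt_trans lm; rewrite divr_ge0.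
(* Then [th * m = l / 2], which gives the constant [1/2 - 3/16 = 5/16]. *)
pose th := l%:R / (2 * m).
have th01 : 0 <= th <= 1.
  rewrite divr_ge0 ?mulr_ge0//= ler_pdivrMr ?mulr_gt0//; lra.
have [th0 _] := andP th01.
have : t * th * m <= s + t * th ^+ 2 / (4 * l%:R) *
    (m + \sum_(i < n) \sum_(j < n | j != i) p i * p j).
  have mN : measurable_fun setT (fun w => \sum_(i < n) (t < y i w)%R%:R : R).
    exact: measurable_sum.
  have N0 w : 0 <= \sum_(i < n) (t < y i w)%R%:R :> R by exact: sumr_ge0.
  have NE : (\int[P]_w (\sum_(i < n) (t < y i w)%R%:R)%:E = m%:E)%E.
    exact: ge0_integral_EFin_sum.
  apply: (ge0_le_integralD_EFin (mu := P)
      (f := fun w => t * th * \sum_(i < n) (t < y i w)%R%:R)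
      (h := fun w => \sum_(i < n) (t < y i w)%R%:R +
        \sum_(i < n) \sum_(j < n | j != i) (t < y i w)%R%:R * (t < y j w)%R%:R)
      _ mS _ _ S0 _ _ _ SE _).
  + exact: measurable_funM.
  + exact: measurable_funD.
  + by move=> w; apply: mulr_ge0 => //; exact: mulr_ge0.
  + by move=> w; rewrite addr_ge0.
  + apply: divr_ge0; apply: mulr_ge0 => //; exact: sqr_ge0.
  + rewrite EFinM -NE -ge0_integralZl_EFin//.
    * by move=> w _; rewrite lee_fin.
    * exact/measurable_EFinP.
    * exact: mulr_ge0.
  + rewrite EFinD -NE -n11E -ge0_integralD//.
    * by move=> w _; rewrite lee_fin.
    * exact/measurable_EFinP.
    * by move=> w _; rewrite lee_fin.
    * exact/measurable_EFinP.
  + by move=> w; exact: sum_kmax_ge_count.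
have := sumD _ p0; rewrite -/m.
set Q := \sum_(i < n) _ => Qm h.
have thm : th * m = l%:R / 2 by rewrite /th; field; lra.
(* Here [Q <= m * m], and [m > l / 2 >= 1 / 2] gives [m + m * m <= 3 * m * m]. *)
have : t * th ^+ 2 / (4 * l%:R) * (m + Q) <= 3 / 16 * (l%:R * t).
  apply: (@le_trans _ _ (t * th ^+ 2 / (4 * l%:R) * (m * (3 * m)))).
    apply: ler_wpM2l; last nra.
    by apply: divr_ge0; apply: mulr_ge0 => //; exact: sqr_ge0.
  rewrite [leLHS](_ : _ = 3 * t * (th * m) ^+ 2 / (4 * l%:R)); last by field; lra.
  rewrite thm [leLHS](_ : _ = 3 / 16 * (l%:R * t))//; field; lra.
move: h; rewrite -mulrA thm.
have : 0 <= l%:R * t by rewrite mulr_ge0.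
lra.
Qed.

(** * Comparison with the Luxemburg norm *)

Lemma eq_integral_identically_distributed (R : realType) (d : measure_display)
    (T : measurableType d) (P : probability T R) (X Y : {RV P >-> R})
    (f : R -> R) :
  identically_distributed X Y -> measurable_fun setT f ->
  (forall x, 0 <= f x) ->
  (\int[P]_w (f (X w))%:E = \int[P]_w (f (Y w))%:E)%E.
Proof.
move=> XY /measurable_EFinP mf f0.
have f0E v : (0 <= (EFin \o f) v)%E by rewrite lee_fin.
rewrite -(ge0_integral_distribution X mf f0E) -(ge0_integral_distribution Y mf f0E).
by apply: eq_measure_integral => A mA _; exact: XY.
Qed.

Lemma measurable_excess (R : realType) (a t : R) :
  measurable_fun setT (fun v : R => Num.max (`|a * v| - t) 0).
Proof.
apply: measurable_maxr => //; apply: measurable_funB => //.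
by apply: measurableT_comp => //; exact: measurable_funM.
Qed.

Section luxemburg_norm_bounds.
Context (R : realType) (d : measure_display) (T : measurableType d)
  (P : probability T R) (n : nat) (X0 : {RV P >-> R})
  (X : 'I_n -> {RV P >-> R}) (l : nat).
Hypotheses (ind : mutually_independent X)
  (idd : forall i, identically_distributed (X i) X0)
  (iX0 : ('E_P[fun w => `|X0 w|%R] < +oo)%E) (ln : (1 <= l <= n)%N).
(** The norm bounds rest on the closed form of [M] alone; [N] stands for any function with this form
    on nonnegative arguments. *)
Variable N : R -> \bar R.
Hypothesis NE : forall s, 0 <= s ->
  N s = (\int[P]_w (Num.max (s * `|X0 w| - 1 / l%:R) 0)%:E)%E.
Variable x : 'rV[R]_n.

Let y i w := `|x ord0 i * X i w|.
Let my i : measurable_fun setT (y i).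
Proof. by apply: measurableT_comp => //; exact: measurable_funM. Qed.
Let y0 i w : 0 <= y i w. Proof. exact: normr_ge0. Qed.
Let l0 : (0 : R) < l%:R. Proof. by rewrite ltr0n; case/andP: ln. Qed.

Let excess (r : R) i := (\int[P]_w (Num.max (y i w - r / l%:R) 0)%:E)%E.

(** Scaling: with [s = |x_i| / r], multiplying [(s |X0| - 1/l)_+] by [r] moves the threshold to
    [r / l]; moreover [X i] is distributed as [X0]. *)
Let NexcessE r i : 0 < r -> (r%:E * N (`|x ord0 i| / r) = excess r i)%E.
Proof.
move=> r0; rewrite NE; last by rewrite divr_ge0// ltW.
rewrite /excess (eq_integral_identically_distributed (idd i)
  (@measurable_excess _ (x ord0 i) (r / l%:R))); last first.
  by move=> v; rewrite le_max lexx orbT.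
rewrite -ge0_integralZl_EFin//; last 3 first.
- by move=> w _; rewrite lee_fin le_max lexx orbT.
- apply/measurable_EFinP/measurable_maxr => //; apply: measurable_funB => //.
  by apply: measurable_funM => //; exact: measurableT_comp.
- exact: ltW.
apply: eq_integral => w _; rewrite -EFinM; congr EFin.
rewrite maxr_pMr ?ltW// mulr0 normrM; congr (Num.max _ _).
by field; rewrite !gt_eqF.
Qed.

Let excess_ge0 r i : (0 <= excess r i)%E.
Proof. by apply: integral_ge0 => w _; rewrite lee_fin le_max lexx orbT. Qed.

Let N_sumE r : 0 < r ->
  (\sum_(i < n) N (`|x ord0 i| / r) <= 1)%E = (\sum_(i < n) excess r i <= r%:E)%E.
Proof.
move=> r0; rewrite -(@lee_pmul2l _ r%:E)// mule1.
rewrite ge0_sume_distrr; last first.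
  move=> i _; rewrite NE; last by rewrite divr_ge0// ltW.
  by apply: integral_ge0 => w _; rewrite lee_fin le_max lexx orbT.
by under eq_bigr do rewrite NexcessE//.
Qed.

Let ES := ('E_P[fun w => (\sum_(1 <= k < l.+1)
                            kmax k (fun i => `|x ord0 i * X i w|))%R])%E.

Let ESE : ES = (\int[P]_w (\sum_(1 <= k < l.+1) kmax k (fun i => y i w))%:E)%E.
Proof. by rewrite /ES unlock. Qed.

(** For each [r] admissible in the norm, the threshold [t = r / l] makes both [l * t] and the total
    expected excess at most [r]; then pass to the infimum. *)
Lemma expectation_sum_kmax_le_luxemburg : (ES <= 2%:E * luxemburg_norm N x)%E.
Proof.
rewrite -lee_pdivrMl//; apply: le_ereal_inf_tmp => _ [r [r0 +] <-].
rewrite N_sumE// => h; rewrite lee_pdivrMl// ESE.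
apply: (le_trans (expectation_sum_kmax_le P ln my y0 (t := r / l%:R) _)).
  by rewrite divr_ge0 ?ltW.
have -> : r / l%:R *+ l = r by rewrite -mulr_natr divfK ?gt_eqF.
have -> : (2%:E * r%:E = r%:E + r%:E)%E.
  by rewrite -EFinM -EFinD; congr EFin; ring.
exact: leeD.
Qed.

Lemma luxemburg_le_expectation_sum_kmax :
  ((4^-1)%:E * luxemburg_norm N x <= ES)%E.
Proof.
have ES0 : (0 <= ES)%E by rewrite /ES unlock; apply: integral_ge0 => w _;
  rewrite lee_fin; have := @sum_kmax_ge_min R n l (y^~ w) 0 0 ln;
  rewrite mul0r; apply => //; apply: sumr_ge0.
(* Suppose that [lam = 4 ES + r] is below the norm for some [r > 0]. Then [lam] is not admissible,
   the expected excesses over [lam / l] total more than [lam], and the converse estimate gives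
   [ES >= lam / 4 > ES]. *)
rewrite lee_pdivrMl//; apply/lee_addgt0Pr => r r0.
rewrite leNgt; apply/negP => lt_norm.
have ESfin : ES \is a fin_num.
  rewrite ge0_fin_numE// ltey; apply/eqP => ESy; move: lt_norm; rewrite ESy.
  by rewrite gt0_muley// ltNge leey.
pose lam := 4 * fine ES + r.
have lam0 : 0 < lam by rewrite ltr_wpDl// mulr_ge0// fine_ge0.
have lamE : (4%:E * ES + r%:E = lam%:E)%E by rewrite -(fineK ESfin).
have nlam : ~ (\sum_(i < n) N (`|x ord0 i| / lam) <= 1)%E.
  move=> h; move: lt_norm; rewrite lamE ltNge => /negP; apply.
  by apply: ereal_inf_lbound; exists lam.
rewrite N_sumE// in nlam.
have efin i : excess lam i \is a fin_num.
  rewrite ge0_fin_numE// /excess (eq_integral_identically_distributed (idd i)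
    (@measurable_excess _ (x ord0 i) (lam / l%:R))); last first.
    by move=> v; rewrite le_max lexx orbT.
  apply: (@le_lt_trans _ _ ((`|x ord0 i|)%:E * 'E_P[fun w => `|X0 w|%R])%E).
    rewrite unlock -ge0_integralZl_EFin//; last first.
      by apply/measurable_EFinP; exact: measurableT_comp.
    apply: ge0_le_integral => //.
    - by move=> w _; rewrite lee_fin le_max lexx orbT.
    - apply/measurable_EFinP.
      by apply: (measurableT_comp (@measurable_excess _ (x ord0 i) (lam / l%:R))).
    - apply/measurable_EFinP; apply: measurable_funM => //.
      exact: measurableT_comp.
    - move=> w _; rewrite lee_fin ge_max normrM mulr_ge0// andbT gerBl.
      by rewrite divr_ge0 ?ltW.
  exact: lte_mul_pinfty.
pose t : R := lam / l%:R; pose B i := [set v : R | t < `|x ord0 i * v|].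
have mB i : measurable (B i).
  rewrite (_ : B i = setT `&` (fun v : R => `|x ord0 i * v|) @^-1` `]t, +oo[).
    apply: measurableT_comp => //; exact: measurable_funM.
  by rewrite setTI; apply/seteqP; split => v /=; rewrite in_itv/= andbT.
have indB i w : \1_(B i) (X i w) = (t < y i w)%R%:R :> R.
  by rewrite indicE; congr (nat_of_bool _)%:R; apply/idP/idP; rewrite inE.
have mXB i : measurable (X i @^-1` B i) by exact: measurable_funPTI.
have pE i : (\int[P]_w ((t < y i w)%R%:R)%:E = P (X i @^-1` B i))%E.
  under eq_integral do rewrite -indB.
  by rewrite -[X in (P X)%E]setIT -integral_indic.
have pfin i : P (X i @^-1` B i) \is a fin_num by rewrite fin_num_measure.
have : ((l%:R * t / 4)%:E <= ES)%E.
  rewrite ESE.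
  apply: (expectation_sum_kmax_ge (e := fun i => fine (excess lam i))
    (p := fun i => fine (P (X i @^-1` B i))) ln my y0).
  - by rewrite divr_ge0 ?ltW.
  - by move=> i; rewrite fineK.
  - by move=> i; rewrite pE fineK.
  - move=> i j ij; rewrite EFinM !fineK// -pE.
    under eq_integral do rewrite -indB -indB.
    under [in RHS]eq_integral do rewrite -indB.
    by rewrite (integral_independent (f := \1_(B i)) ind ij).
  - move=> i j ij; rewrite EFinM !fineK//.
    under eq_integral do rewrite -indB.
    rewrite (integral_independent
      (f := fun v => Num.max (`|x ord0 i * v| - t) 0) ind ij)//.
      exact: measurable_excess.
    by move=> v; rewrite le_max lexx orbT.
  - rewrite -lee_fin -sumEFin; under eq_bigr do rewrite fineK//.
    by rewrite mulrCA divff ?gt_eqF// mulr1 ltW// ltNge; apply/negP.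
rewrite mulrCA divff ?gt_eqF// mulr1 -(fineK ESfin) lee_fin /lam; lra.
Qed.

End luxemburg_norm_bounds.

(** * The decreasing rearrangement and its integral *)

Section rearrangement_integral.
Context (R : realType) (d : measure_display) (T : measurableType d)
  (P : probability T R) (X : {RV P >-> R}).

Lemma measurable_abs_tail u : measurable [set w | (u < `|X w|)%R].
Proof.
rewrite -[X in measurable X]setTI (_ : [set w | _] = (fun w => `|X w|) @^-1` `]u, +oo[).
  by apply: measurableT_comp.
by apply/seteqP; split => w /=; rewrite in_itv/= andbT.
Qed.

Let Q := rearrangement P X.
Let tail (u : R) := P [set w | (u < `|X w|)%R].

Let tail_fin u : tail u \is a fin_num.
Proof. by rewrite fin_num_measure//; exact: measurable_abs_tail. Qed.

Let tail_le u v : u <= v -> (tail v <= tail u)%E.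
Proof.
move=> uv; apply: le_measure; rewrite ?inE; [exact: measurable_abs_tail..|].
by move=> w /=; exact: le_lt_trans.
Qed.

Lemma rearrangement_ge0 z : (0 <= Q z)%E.
Proof. by apply: le_ereal_inf_tmp => _ [s [s0 _] <-]; rewrite lee_fin. Qed.

Lemma rearrangement_nonincreasing z1 z2 : z1 <= z2 -> (Q z2 <= Q z1)%E.
Proof.
move=> z12; apply: ereal_inf_le_tmp => _ [s [s0 sz] <-]; exists s => //.
by split => //; apply: (le_trans sz); rewrite lee_fin.
Qed.

(** The rearrangement is the generalized inverse of the tail [P(|X| > u)]. The nontrivial direction
    is right continuity of the tail, obtained from the increasing events [|X| > u + 1/(k+1)]. *)
Lemma lt_rearrangement u z : 0 <= u -> (u%:E < Q z)%E = (z%:E < tail u)%E.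
Proof.
move=> u0; apply/idP/idP; apply: contraTT; rewrite -!leNgt => h.
  by apply: ereal_inf_lbound; exists u.
pose F k := [set w | u + k.+1%:R^-1 < `|X w|].
have Fcup : \bigcup_k F k = [set w | u < `|X w|].
  apply/seteqP; split => [w [k _]|w /= uw].
    by apply: lt_trans; rewrite ltrDl.
  have [k] := ltr_add_invr uw.
  by exists k.
rewrite /tail -Fcup.
have cvF : (P (F k) @[k --> \oo] --> P (\bigcup_k F k))%E.
  apply: nondecreasing_cvg_mu.
  - by move=> k; exact: measurable_abs_tail.
  - by rewrite Fcup; exact: measurable_abs_tail.
  - move=> k m km; apply/subsetPset => w; apply: le_lt_trans.
    by rewrite lerD2l lef_pV2 ?posrE// ler_nat.
rewrite -(cvg_lim _ cvF)//; apply: lime_le; first by apply: cvgP cvF.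
apply: nearW => k; rewrite leNgt; apply/negP => zk.
have : (Q z < (u + k.+1%:R^-1)%:E)%E.
  by apply: (le_lt_trans h); rewrite lte_fin ltrDl.
move=> /ereal_inf_lt[_ [s [s0 sz] <-]]; rewrite lte_fin => su.
move: zk; rewrite ltNge => /negP; apply; apply: le_trans sz.
by apply: tail_le; exact: ltW.
Qed.

Lemma measurable_rearrangement : measurable_fun setT Q.
Proof.
move=> _; apply: (measurability _ (ErealGenOInfty.measurableE R)) => //.
move=> _ [_ [u ->] <-]; rewrite setTI.
have [u0|u0] := leP 0 u.
  rewrite (_ : _ @^-1` _ = `]-oo, fine (tail u)[%classic)//.
  apply/seteqP; split => z /=; rewrite !in_itv/= andbT lt_rearrangement//.
    by rewrite -lte_fin fineK.
  by rewrite -lte_fin fineK.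
rewrite (_ : _ @^-1` _ = setT)//; apply/seteqP; split => z //= _.
rewrite in_itv/= andbT; apply: (lt_le_trans _ (rearrangement_ge0 z)).
by rewrite lte_fin.
Qed.

(** For [s > 0] and [a = 1 / (s l)], the value [M(s)] equals [s * mean_excess a]. *)
Definition mean_excess (a : R) := (\int[P]_w (Num.max (`|X w| - a) 0)%:E)%E.

Let mexcess a : measurable_fun setT (fun z => maxe (Q z - a%:E) 0)%E.
Proof.
apply: measurable_maxe => //; apply: emeasurable_funB => //.
exact: measurable_rearrangement.
Qed.

(** Equimeasurability: apply the layer cake formula to both sides; the points of [0, 1] where [X^*]
    exceeds [a + u] form the interval from 0 to [P(|X| > a + u)]. *)
Lemma integral_rearrangement_excess (a : R) : 0 <= a ->
  (\int[lebesgue_measure]_(z in `[0%R, 1%R]) maxe (Q z - a%:E) 0 =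
   mean_excess a)%E.
Proof.
move=> a0; rewrite integral_mkcond ge0_integral_layer_cake; last 2 first.
- by apply/(measurable_restrictT _ _).1; [|apply: measurable_funTS; exact: mexcess].
- by move=> z; apply: erestrict_ge0 => ? _; rewrite le_max lexx orbT.
rewrite /mean_excess ge0_integral_layer_cake; last 2 first.
- apply/measurable_EFinP/measurable_maxr => //; apply: measurable_funB => //.
  exact: measurableT_comp.
- by move=> w; rewrite lee_fin le_max lexx orbT.
apply: eq_integral => u; rewrite inE/= in_itv/= andbT => u0.
have -> : [set w | (u%:E < (Num.max (`|X w| - a) 0)%:E)%E] =
    [set w | a + u < `|X w|].
  apply/seteqP; split => w /=; rewrite lte_fin lt_max ltrBrDl.
    by move=> /orP[//|]; rewrite ltNge u0.
  by move=> ->.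
rewrite (_ : [set z | _] = `[0, fine (tail (a + u))[%classic).
  rewrite lebesgue_measure_itv/= lte_fin; case: ltP => h.
    by rewrite sube0 fineK.
  apply/esym/eqP; rewrite eq_le measure_ge0 andbT.
  by move: h; rewrite -lee_fin fineK.
have tail1 : fine (tail (a + u)) <= 1.
  by rewrite -lee_fin fineK// probability_le1//; exact: measurable_abs_tail.
have key z : (u%:E < maxe (Q z - a%:E) 0)%E = (z < fine (tail (a + u))).
  rewrite -lte_fin fineK// -lt_rearrangement ?addr_ge0// lt_max.
  rewrite [(u%:E < 0%:E)%E]lte_fin [u < 0]ltNge u0 orbF EFinD lteBrDl//.
apply/seteqP; split => z /=; rewrite patchE in_itv/=.
  case: ifPn; last by rewrite ltNge lee_fin u0.
  by rewrite key inE/= in_itv/= => /andP[-> _].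
move=> /andP[z0 zt]; rewrite mem_set ?key//= in_itv/= z0/=.
exact: le_trans (ltW zt) tail1.
Qed.

Let Fint (b : R) := (\int[lebesgue_measure]_(z in `[0%R, b]) Q z)%E.

Let ex_ge0 a z : (0 <= maxe (Q z - a%:E) 0)%E.
Proof. by rewrite le_max lexx orbT. Qed.

Let integral_cst_ex (a b : R) (B : bool) : 0 <= a -> 0 <= b ->
  (\int[lebesgue_measure]_(z in [set` Interval (BLeft 0%R) (BSide B b)])
      (a%:E + maxe (Q z - a%:E) 0) =
  (a * b)%:E + \int[lebesgue_measure]_(z in [set` Interval (BLeft 0%R) (BSide B b)])
      maxe (Q z - a%:E) 0)%E.
Proof.
move=> a0 b0; rewrite ge0_integralD//; last by apply: measurable_funTS; exact: mexcess.
congr (_ + _)%E; rewrite integral_cst//= lebesgue_measure_itv/= lte_fin EFinM.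
by case: (ltgtP 0 b) b0 => // [_ _|<- _]; rewrite ?sube0.
Qed.

(** Integrate [X^* <= a + (X^* - a)_+] over [0, b], then enlarge the domain of the excess to
    [0, 1]. *)
Lemma integral_rearrangement_le (a b : R) : 0 <= a -> 0 <= b <= 1 ->
  (Fint b <= (a * b)%:E + mean_excess a)%E.
Proof.
move=> a0 /andP[b0 b1].
apply: (@le_trans _ _ (\int[lebesgue_measure]_(z in `[0%R, b])
    (a%:E + maxe (Q z - a%:E) 0))%E).
  apply: ge0_le_integral => //.
  - by move=> z _; exact: rearrangement_ge0.
  - by apply: measurable_funTS; exact: measurable_rearrangement.
  - by apply: emeasurable_funD => //; apply: measurable_funTS; exact: mexcess.
  - by move=> z _; rewrite -leeBlDl// le_max lexx.
rewrite integral_cst_ex// leeD2l// -integral_rearrangement_excess//.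
apply: ge0_subset_integral => //.
  by apply: measurable_funTS; exact: mexcess.
by apply: subset_itvl; rewrite bnd_simp.
Qed.

(** The equality case: [X^* = a + (X^* - a)_+] before the crossing point [b], and the excess
    vanishes from [b] on. The proof passes to the half-open interval because at [b] itself only
    [X^* <= a] is given. *)
Lemma integral_rearrangement_ge (a b : R) : 0 <= a -> 0 <= b <= 1 ->
  (forall z, 0 <= z < b -> (a%:E <= Q z)%E) ->
  (forall z, b <= z <= 1 -> (Q z <= a%:E)%E) ->
  ((a * b)%:E + mean_excess a <= Fint b)%E.
Proof.
move=> a0 /andP[b0 b1] above below.
apply: (@le_trans _ _ (\int[lebesgue_measure]_(z in `[0%R, b[) Q z)%E); last first.
  apply: ge0_subset_integral => //.
  - by apply: measurable_funTS; exact: measurable_rearrangement.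
  - by move=> z _; exact: rearrangement_ge0.
  - by apply: subset_itvl; rewrite bnd_simp.
have -> : (\int[lebesgue_measure]_(z in `[0%R, b[) Q z =
    \int[lebesgue_measure]_(z in `[0%R, b[) (a%:E + maxe (Q z - a%:E) 0))%E.
  apply: eq_integral => z; rewrite inE/= in_itv/= => /above h.
  by rewrite EFinN max_l; [rewrite addeC subeK|rewrite sube_ge0].
rewrite integral_cst_ex// leeD2l// -integral_rearrangement_excess//.
rewrite integral_mkcond [leRHS]integral_mkcond le_eqVlt; apply/orP; left.
apply/eqP; apply: eq_integral => z _; rewrite !patchE !mem_setE !in_itv/=.
case: (leP 0 z) => //= z0; case: (ltP z b) => zb.
  by rewrite (ltW (lt_le_trans zb b1)).
case: ifP => // z1; rewrite ?EFinN max_r// sube_le0; apply: below.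
by rewrite zb z1.
Qed.

Lemma integral_rearrangement1 : Fint 1 = ('E_P[fun w => `|X w|%R])%E.
Proof.
have E0 : mean_excess 0 = ('E_P[fun w => `|X w|%R])%E.
  rewrite /mean_excess unlock; apply: eq_integral => w _.
  by rewrite subr0 max_l.
apply/eqP; rewrite eq_le -E0; apply/andP; split.
  by apply: (le_trans (integral_rearrangement_le (a := 0) (b := 1) _ _)) => //;
    rewrite ?ler01 ?lexx// mul0r add0e.
(* The level [a = 0] is crossed at [b = 1]: the tail never exceeds 1, so [X^*(1) = 0]. *)
have -> : mean_excess 0 = ((0 * 1)%:E + mean_excess 0)%E by rewrite mul0r add0e.
apply: integral_rearrangement_ge => // [|z _|z /andP[z1 _]].
- by rewrite ler01 lexx.
- exact: rearrangement_ge0.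
- rewrite leNgt lt_rearrangement// -leNgt.
  apply: (le_trans (probability_le1 _ _)); last by rewrite lee_fin.
  exact: measurable_abs_tail.
Qed.

Lemma integral_rearrangement_mono b1 b2 : b1 <= b2 -> (Fint b1 <= Fint b2)%E.
Proof.
move=> b12; apply: ge0_subset_integral => //.
- by apply: measurable_funTS; exact: measurable_rearrangement.
- by move=> z _; exact: rearrangement_ge0.
- by apply: subset_itvl; rewrite bnd_simp.
Qed.

Hypothesis iX : ('E_P[fun w => `|X w|%R] < +oo)%E.

Let Fint_fin b : b <= 1 -> Fint b \is a fin_num.
Proof.
move=> b1; rewrite ge0_fin_numE.
  apply: le_lt_trans iX; rewrite -integral_rearrangement1.
  exact: integral_rearrangement_mono.
by apply: integral_ge0 => z _; exact: rearrangement_ge0.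
Qed.

(** By monotonicity an infinite value at [z] would persist on [0, z], where the constant
    [(Fint z + 1) / z] already has too large an integral. The point 0 is excluded since [X^*(0)] is
    infinite for unbounded [X]. *)
Lemma rearrangement_fin z : 0 < z <= 1 -> Q z \is a fin_num.
Proof.
move=> /andP[z0 z1]; rewrite ge0_fin_numE ?rearrangement_ge0//.
rewrite ltey; apply/eqP => Qy.
have : (((fine (Fint z) + 1) / z)%:E * z%:E <= Fint z)%E.
  have <- : (\int[lebesgue_measure]_(t in `[0%R, z])
      ((fine (Fint z) + 1) / z)%:E = ((fine (Fint z) + 1) / z)%:E * z%:E)%E.
    by rewrite integral_cst//= lebesgue_measure_itv/= lte_fin z0 sube0.
  have F0 : 0 <= fine (Fint z).
    by apply: fine_ge0; apply: integral_ge0 => t _; exact: rearrangement_ge0.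
  apply: ge0_le_integral => //.
  - by move=> t _; rewrite lee_fin divr_ge0 ?addr_ge0// ltW.
  - by apply: measurable_funTS; exact: measurable_rearrangement.
  - move=> t /=; rewrite in_itv/= => /andP[_ tz].
    apply: le_trans (rearrangement_nonincreasing tz).
    by rewrite Qy leey.
rewrite -EFinM divfK ?gt_eqF// -[leRHS]fineK ?Fint_fin// lee_fin.
by rewrite gerDl ler10.
Qed.

Lemma integral_rearrangement_IVT (s : R) :
  0 <= s -> (s%:E <= 'E_P[fun w => `|X w|%R])%E ->
  exists2 b, 0 <= b <= 1 & Fint b = s%:E.
Proof.
(* Continuity of the integral is applied to a real integrand: [fine] replaces a possibly infinite
   value at 0 by 0, and this null point does not affect the integrals. *)
move=> s0 sE; pose f z := fine (Q z).
have mQ := measurable_rearrangement.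
have mf : measurable_fun setT f by exact: measurableT_comp.
have fE b : 0 <= b <= 1 ->
    (\int[lebesgue_measure]_(z in `[0%R, b]) (f z)%:E = Fint b)%E.
  move=> /andP[b0 b1]; rewrite /Fint -integral_itv_obnd_cbnd; last first.
    by apply: measurable_funTS; exact/measurable_EFinP.
  rewrite -[RHS]integral_itv_obnd_cbnd; last exact: measurable_funTS.
  apply: eq_integral => z; rewrite inE/= in_itv/= => /andP[z0 zb].
  by rewrite /f fineK// rearrangement_fin// z0 (le_trans zb).
have if1 : lebesgue_measure.-integrable `[0, 1] (EFin \o f).
  apply/integrableP; split.
    by apply/measurable_EFinP; exact: measurable_funTS.
  rewrite (_ : (\int[_]_(x in _) _)%E = Fint 1).
    by rewrite integral_rearrangement1.
  rewrite -fE ?ler01 ?lexx//; apply: eq_integral => z _ /=.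
  by rewrite ger0_norm// fine_ge0// rearrangement_ge0.
have := parameterized_integral_continuous ler01 if1.
set g := (X in continuous X) => cg.
have gE b : 0 <= b <= 1 -> g b = fine (Fint b).
  by move=> b01; congr fine; exact: fE.
have g0 : g 0 = 0 by rewrite gE ?lexx ?ler01// /Fint set_itv1 integral_set1.
have g1 : s <= g 1.
  rewrite gE ?ler01 ?lexx// -lee_fin fineK ?Fint_fin//.
  by rewrite integral_rearrangement1.
have [|b] := IVT ler01 cg (v := s).
  by rewrite g0 ge_min s0/= le_max g1 orbT.
rewrite in_itv/= => b01; rewrite gE// => bs; exists b => //.
by rewrite -bs fineK// Fint_fin//; case/andP: b01.
Qed.

End rearrangement_integral.

(** * Conjugate and explicit formulas for [M] *)

Section conjugates.
Context (R : realType) (d : measure_display) (T : measurableType d)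
  (P : probability T R) (X : {RV P >-> R}) (l : nat).
Hypotheses (iX : ('E_P[fun w => `|X w|%R] < +oo)%E) (l0 : (0 < l)%N).

Let EX := ('E_P[fun w => `|X w|%R])%E.
Let Fint (b : R) :=
  (\int[lebesgue_measure]_(z in `[0%R, b]) rearrangement P X z)%E.
Let Mval (s : R) := (\int[P]_w (Num.max (s * `|X w| - 1 / l%:R) 0)%:E)%E.
Let lgt : (0 : R) < l%:R. Proof. by rewrite ltr0n. Qed.

Let EX_fin : EX \is a fin_num.
Proof.
rewrite ge0_fin_numE// /EX unlock; apply: integral_ge0 => w _.
by rewrite lee_fin.
Qed.

Let MvalE s a : 0 <= s -> s * a = 1 / l%:R ->
  (Mval s = s%:E * mean_excess X a)%E.
Proof.
move=> s0 sa; rewrite -ge0_integralZl_EFin//; last 2 first.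
- by move=> w _; rewrite lee_fin le_max lexx orbT.
- apply/measurable_EFinP/measurable_maxr => //; apply: measurable_funB => //.
  exact: measurableT_comp.
apply: eq_integral => w _; rewrite -EFinM; congr EFin.
by rewrite maxr_pMr// mulr0 mulrBr sa.
Qed.

Let Mval_ge0 s : (0 <= Mval s)%E.
Proof. by apply: integral_ge0 => w _; rewrite lee_fin le_max lexx orbT. Qed.

Let Mval0 : Mval 0 = 0%E.
Proof.
apply: integral0_eq => w _; congr EFin; apply/max_idPr.
by rewrite mul0r sub0r oppr_le0 divr_ge0.
Qed.

Let Mval_le s : 0 <= s -> (Mval s <= s%:E * EX)%E.
Proof.
move=> s0; rewrite /EX unlock -ge0_integralZl_EFin//; last first.
  by apply/measurable_EFinP; exact: measurableT_comp.
apply: ge0_le_integral => //.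
- by move=> w _; rewrite lee_fin le_max lexx orbT.
- apply/measurable_EFinP/measurable_maxr => //; apply: measurable_funB => //.
  by apply: measurable_funM => //; exact: measurableT_comp.
- apply/measurable_EFinP; apply: measurable_funM => //.
  exact: measurableT_comp.
- move=> w _; rewrite lee_fin ge_max mulr_ge0// andbT gerBl.
  by rewrite divr_ge0.
Qed.

Let Mval_fin s : 0 <= s -> Mval s \is a fin_num.
Proof.
move=> s0; rewrite ge0_fin_numE//; apply: (le_lt_trans (Mval_le s0)).
exact: lte_mul_pinfty.
Qed.

Let Fint_ge0 b : (0 <= Fint b)%E.
Proof. by apply: integral_ge0 => z _; exact: rearrangement_ge0. Qed.

Let Fint_le b : b <= 1 -> (Fint b <= EX)%E.
Proof.
move=> b1; rewrite /EX -integral_rearrangement1.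
exact: integral_rearrangement_mono.
Qed.

Let Fint_fin b : b <= 1 -> Fint b \is a fin_num.
Proof. by move=> /Fint_le h; rewrite ge0_fin_numE//; apply: le_lt_trans h iX. Qed.

(** Young's inequality: [s] times the bound on [Fint b] at the level [a = 1 / (s l)], where
    [s a b = b / l]. The level makes no sense for [s = 0], which is treated apart. *)
Let young s b : 0 <= s -> 0 <= b <= 1 ->
  (s%:E * Fint b <= Mval s + (b / l%:R)%:E)%E.
Proof.
rewrite le_eqVlt => /predU1P[<- /andP[b0 b1]|s0 b01].
  by rewrite mul0e adde_ge0// lee_fin divr_ge0.
have sa : s * (1 / (s * l%:R)) = 1 / l%:R by field; rewrite !gt_eqF.
have a0 : 0 <= 1 / (s * l%:R) by rewrite divr_ge0// mulr_ge0// ltW.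
rewrite (MvalE (ltW s0) sa).
apply: (le_trans (lee_wpmul2l _ (integral_rearrangement_le X a0 b01))).
  by rewrite lee_fin ltW.
rewrite ge0_muleDr//; last 2 first.
- by rewrite lee_fin mulr_ge0//; case/andP: b01.
- by apply: integral_ge0 => w _; rewrite lee_fin le_max lexx orbT.
by rewrite addeC -EFinM mulrA sa mul1r [_^-1 * _]mulrC.
Qed.

Let Mstar_ge0 s : (0 <= Mstar P X l s)%E.
Proof.
rewrite /Mstar; case: ifP => // _; apply: le_ereal_inf_tmp => _ [b [/andP[b0 _] _] <-].
by rewrite lee_fin divr_ge0.
Qed.

Let Mstar_le s b : 0 <= b <= 1 -> Fint b = s%:E ->
  (Mstar P X l s <= (b / l%:R)%:E)%E.
Proof.
move=> b01 Fb; rewrite /Mstar ifF; last first.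
  by apply/negbTE; rewrite -leNgt -Fb; apply: Fint_le; case/andP: b01.
by apply: ereal_inf_lbound; exists b.
Qed.

Let young_Mstar s t : 0 <= s -> ((s * t)%:E - Mval s <= Mstar P X l t)%E.
Proof.
move=> s0; rewrite /Mstar; case: ifPn => [_|_]; first by rewrite leey.
apply: le_ereal_inf_tmp => _ [b [b01 Fb] <-].
by rewrite leeBlDl ?Mval_fin// EFinM -Fb; exact: young.
Qed.

(** For [s > 0], Young's inequality is an equality at [b = P(|X| > a)], where [X^*] crosses the
    level [a = 1 / (s l)]; the supremum is attained at [t = \int_0^b X^*]. *)
Lemma MfunE s : 0 <= s ->
  Mfun P X l s = (\int[P]_w (Num.max (s * `|X w| - 1 / l%:R) 0)%:E)%E.
Proof.
move=> s0; rewrite -/(Mval s); apply/eqP; rewrite eq_le; apply/andP; split.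
  apply: ge_ereal_sup => _ [t t0 <-]; have := young_Mstar t s0.
  have := Mstar_ge0 t; rewrite -(fineK (Mval_fin s0)).
  case: (Mstar P X l t) => [r _|_ _|//]; last by rewrite addeNy leNye.
  by rewrite -!EFinB !lee_fin; lra.
have [->|sn0] := eqVneq s 0.
  apply: le_ereal_sup_tmp; exists ((0 * 0)%:E - Mstar P X l 0)%E.
    by exists 0; rewrite /= ?lexx.
  rewrite Mval0 mul0r sub0e oppe_ge0; apply: (le_trans (Mstar_le (b := 0) _ _)).
  - by rewrite lexx ler01.
  - by rewrite /Fint set_itv1 integral_set1.
  - by rewrite mul0r.
have {sn0} s0 : 0 < s by rewrite lt_def sn0.
pose a := 1 / (s * l%:R).
have sa : s * a = 1 / l%:R by rewrite /a; field; rewrite !gt_eqF.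
have a0 : 0 <= a by rewrite divr_ge0// mulr_ge0// ltW.
have tail_fin : P [set w | (a < `|X w|)%R] \is a fin_num.
  by rewrite fin_num_measure//; exact: measurable_abs_tail.
pose b := fine (P [set w | (a < `|X w|)%R]).
have b01 : 0 <= b <= 1.
  by rewrite fine_ge0//= -lee_fin fineK// probability_le1//; exact: measurable_abs_tail.
have bF : ((a * b)%:E + mean_excess X a <= Fint b)%E.
  apply: integral_rearrangement_ge => // z /andP[].
    by move=> _ zb; rewrite ltW// lt_rearrangement// -(fineK tail_fin) lte_fin.
  by move=> bz _; rewrite leNgt lt_rearrangement// -(fineK tail_fin) lte_fin -leNgt.
have Fbf : Fint b \is a fin_num by apply: Fint_fin; case/andP: b01.
pose t := fine (Fint b).
have tE : Fint b = t%:E by rewrite fineK.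
apply: le_ereal_sup_tmp; exists ((s * t)%:E - Mstar P X l t)%E.
  by exists t => //=; apply: fine_ge0.
apply: (@le_trans _ _ ((s * t)%:E - (b / l%:R)%:E)%E); last first.
  by apply: leeB => //; exact: Mstar_le.
rewrite leeBrDr// (MvalE (ltW s0) sa).
have -> : (b / l%:R)%:E = (s%:E * (a * b)%:E)%E.
  by rewrite -EFinM mulrA sa mul1r mulrC.
rewrite -ge0_muleDr//; last 2 first.
- by apply: integral_ge0 => w _; rewrite lee_fin le_max lexx orbT.
- by rewrite lee_fin mulr_ge0//; case/andP: b01.
by rewrite [(s * t)%:E]EFinM -tE addeC lee_wpmul2l// lee_fin ltW.
Qed.

(** Since [M] is defined as the conjugate of [M^*], this is biconjugation for [M^*], proved by
    exhibiting explicit slopes [t]. *)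
Lemma conjugate_MfunE s : 0 <= s ->
  conjugate (Mfun P X l) s = Mstar P X l s.
Proof.
move=> s0; apply/eqP; rewrite eq_le; apply/andP; split.
  apply: ge_ereal_sup => _ [t t0 <-]; rewrite MfunE// mulrC.
  exact: young_Mstar.
have [Es|sE] := ltP EX s%:E.
  rewrite /Mstar Es -(ereal_sup_real R); apply: ge_ereal_sup => _ [r _ <-].
  have e_lt : fine EX < s by rewrite -lte_fin fineK.
  (* As [M t <= t E|X|], this slope gives [s t - M t >= t (s - E|X|) = max(r, 0)]. *)
  pose t := Num.max r 0 / (s - fine EX).
  have t0 : 0 <= t by rewrite divr_ge0 ?le_max ?lexx ?orbT// subr_ge0 ltW.
  apply: le_ereal_sup_tmp; exists ((s * t)%:E - Mfun P X l t)%E; first by exists t.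
  rewrite MfunE// -/(Mval t) leeBrDl ?Mval_fin//.
  apply: (le_trans (leeD (Mval_le t0) (lexx _))).
  rewrite -(fineK EX_fin) -EFinM -EFinD lee_fin.
  have -> : s * t = t * fine EX + Num.max r 0.
    by rewrite /t; field; rewrite subr_eq0 gt_eqF.
  by rewrite lerD2l le_max lexx.
have [b1 b101 Fb1] := integral_rearrangement_IVT iX s0 sE.
(* Every [r < Mstar s] is dominated: with [b = r l], the supporting slope
   [t = 1 / (l X^*(b))] gives [s t - M t >= b / l = r]. *)
have key r : 0 < r -> (r%:E < Mstar P X l s)%E ->
    (r%:E <= conjugate (Mfun P X l) s)%E.
  move=> r0 rM; pose b := r * l%:R.
  have bl : b / l%:R = r by rewrite /b mulfK// gt_eqF.
  have bb1 : b <= b1.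
    have := lt_le_trans rM (Mstar_le b101 Fb1).
    by rewrite lte_fin ltr_pdivlMr// => /ltW.
  have b0 : 0 < b by rewrite mulr_gt0.
  have b11 : b <= 1 by apply: (le_trans bb1); case/andP: b101.
  have b01 : 0 <= b <= 1 by rewrite (ltW b0).
  have Qfin : rearrangement P X b \is a fin_num.
    by apply: rearrangement_fin => //; rewrite b0.
  pose a := fine (rearrangement P X b).
  have aE : rearrangement P X b = a%:E by rewrite fineK.
  have a0 : 0 <= a by rewrite fine_ge0// rearrangement_ge0.
  have FbE : Fint b = ((a * b)%:E + mean_excess X a)%E.
    apply/eqP; rewrite eq_le integral_rearrangement_le//=.
    apply: integral_rearrangement_ge => // z /andP[zl zr]; rewrite -aE;
      apply: rearrangement_nonincreasing => //; exact: ltW.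
  have Fbs : (Fint b <= s%:E)%E by rewrite -Fb1; exact: integral_rearrangement_mono.
  (* If [X^*(b) = 0], the integral over [0, b] is all of [E|X| >= s], so [b] itself attains [s] and
     [M^*(s) <= b / l = r]. *)
  have a_gt0 : 0 < a.
    rewrite lt_def a0 andbT; apply/eqP => a00; move: rM; apply/negP.
    rewrite -leNgt -bl; apply: Mstar_le => //; apply/eqP; rewrite eq_le Fbs/=.
    rewrite FbE a00 mul0r add0e.
    have := integral_rearrangement_le X (lexx 0) (b := 1).
    rewrite integral_rearrangement1 mul0r add0e => h.
    by apply: (le_trans sE); apply: h; rewrite ler01 lexx.
  pose t := 1 / (l%:R * a).
  have t0 : 0 <= t by rewrite divr_ge0// mulr_ge0.
  have ta : t * a = 1 / l%:R by rewrite /t; field; rewrite !gt_eqF.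
  apply: le_ereal_sup_tmp; exists ((s * t)%:E - Mfun P X l t)%E; first by exists t.
  rewrite MfunE// -/(Mval t) leeBrDl ?Mval_fin// (MvalE t0 ta).
  have -> : r%:E = (t%:E * (a * b)%:E)%E.
    by rewrite -EFinM mulrA ta -bl; congr EFin; ring.
  rewrite -ge0_muleDr//; last 2 first.
  - by apply: integral_ge0 => w _; rewrite lee_fin le_max lexx orbT.
  - by rewrite lee_fin mulr_ge0// ltW.
  by rewrite addeC -FbE [s * t]mulrC [(t * s)%:E]EFinM;
    apply: lee_wpmul2l => //; rewrite lee_fin.
have conj0 : (0 <= conjugate (Mfun P X l) s)%E.
  apply: le_ereal_sup_tmp; exists ((s * 0)%:E - Mfun P X l 0)%E.
    by exists 0; rewrite /= ?lexx.
  by rewrite MfunE// -/(Mval 0) Mval0 mulr0 sube0.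
(* A real [r] strictly between the conjugate and [M^*(s)] would contradict [key]; nonnegativity of
   the conjugate makes this [r] positive. *)
rewrite leNgt; apply/negP; move: key conj0.
case: (conjugate (Mfun P X l) s) => [c| |//] key c0; last by rewrite ltNge leey.
move=> cM; have [r cr rM] : exists2 r : R, c < r & (r%:E < Mstar P X l s)%E.
  case: (Mstar P X l s) cM => [m|_|//].
    by rewrite lte_fin => cm; exists ((c + m) / 2); rewrite ?lte_fin; lra.
  by exists (c + 1); rewrite ?ltry// ltrDl.
have r0 : 0 < r by apply: le_lt_trans cr; rewrite -lee_fin.
have := key r r0 rM.
by rewrite lee_fin leNgt cr.
Qed.

(** For [v = |X w| > 0], the admissible [t] fill [c, s] with [c = 1 / (v l)], and
    [v (s - c) = s v - 1/l]. When [c >= s], both the length and the positive part are zero. *)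
Lemma MexplicitE s : 0 <= s ->
  Mexplicit P X l s = (\int[P]_w (Num.max (s * `|X w| - 1 / l%:R) 0)%:E)%E.
Proof.
move=> s0.
(* The condition on [t] is multiplied out, equivalently since [t > 0], to make joint measurability
   direct. *)
pose A := [set p : measurableTypeR R * T |
  [/\ 0 < p.1, p.1 <= s & 1 <= `|X p.2| * (p.1 * l%:R)]].
have mX2 : measurable_fun setT (fun p : measurableTypeR R * T => `|X p.2|).
  by apply: measurableT_comp => //; exact: measurableT_comp.
have mA : measurable A.
  rewrite (_ : A = (fun p : measurableTypeR R * T => 0 < p.1) @^-1` [set true]
      `&` (fun p : measurableTypeR R * T => p.1 <= s) @^-1` [set true]
      `&` (fun p : measurableTypeR R * T => 1 <= `|X p.2| * (p.1 * l%:R))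
            @^-1` [set true]).
    apply: measurableI; first apply: measurableI; rewrite -[X in measurable X]setTI.
    - by apply: measurable_fun_ltr.
    - by apply: measurable_fun_ler.
    - apply: measurable_fun_ler => //; apply: measurable_funM => //.
      exact: measurable_funM.
  by apply/seteqP; split => p /=; [case|case=> -[]].
pose f (p : measurableTypeR R * T) := (`|X p.2| * \1_A p)%:E.
have condE (t v : R) : 0 < t -> (1 / (t * l%:R) <= v) = (1 <= v * (t * l%:R)).
  by move=> t0; rewrite ler_pdivrMr ?mulr_gt0.
transitivity (\int[lebesgue_measure]_t \int[P]_w f (t, w))%E.
  rewrite /Mexplicit integral_mkcond; apply: eq_integral => t _.
  rewrite patchE; case: ifPn => [|]; rewrite ?notin_setE ?inE/= in_itv/=.
    move=> /andP[t0 ts]; rewrite integral_mkcond; apply: eq_integral => w _.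
    rewrite patchE /f indicE/=; case: ifPn => [|]; rewrite ?notin_setE ?inE/= condE//.
      by move=> h; rewrite mem_set ?mulr1.
    by move=> h; rewrite memNset ?mulr0// => -[].
  move=> ts; apply/esym/integral0_eq => w _; rewrite /f indicE memNset ?mulr0//=.
  by move=> [t0 t1 _]; apply: ts; rewrite t0.
rewrite (fubini_tonelli f)//; last 2 first.
- by apply/measurable_EFinP; apply: measurable_funM => //; exact: measurable_indic.
- by move=> p; rewrite lee_fin mulr_ge0.
apply: eq_integral => w _; rewrite /f/=.
have := normr_ge0 (X w); rewrite le_eqVlt => /predU1P[<-|v0].
  rewrite integral0_eq => [|t _]; last by rewrite mul0r.
  by rewrite mulr0 sub0r max_r// oppr_le0 divr_ge0.
set v := `|X w| in v0 *; pose c := 1 / (v * l%:R).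
have AE t : A (t, w) <-> c <= t <= s.
  have vl : 0 < v * l%:R by rewrite mulr_gt0.
  have cE : (c <= t) = (1 <= v * (t * l%:R)).
    by rewrite /c ler_pdivrMr// mulrCA.
  split=> [[/= t0 ts h]|/andP[ct ts]]; first by rewrite cE h.
  split => //=; last by rewrite -cE.
  by apply: lt_le_trans ct; rewrite divr_gt0.
have cvl : v * (s - c) = s * v - 1 / l%:R by rewrite /c; field; rewrite !gt_eqF.
transitivity (\int[lebesgue_measure]_t (v%:E * (\1_(`[c, s]) t)%:E))%E.
  apply: eq_integral => t _; rewrite -EFinM !indicE; congr (v * (nat_of_bool _)%:R)%:E.
  by apply/idP/idP; rewrite !inE/= in_itv/= => /AE.
rewrite ge0_integralZl_EFin//; last 2 first.
- by apply/measurable_EFinP; exact: measurable_indic.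
- exact: ltW.
rewrite integral_indic// setIT /= lebesgue_measure_itv/= lte_fin.
case: ltP => cs; rewrite -?EFinD ?mule0 -?EFinM ?cvl; congr EFin.
  by rewrite max_l// -cvl mulr_ge0// ?subr_ge0 ltW.
by rewrite max_r// -cvl mulr_ge0_le0// ?subr_le0// ltW.
Qed.
End conjugates.

Theorem theorem1p4 (R : realType) :
  exists c C : R, [/\ 0 < c, 0 < C &
    forall (d : measure_display) (T : measurableType d) (P : probability T R)
      (n : nat) (X0 : {RV P >-> R}) (X : 'I_n -> {RV P >-> R}) (l : nat),
      mutually_independent X ->
      (forall i, identically_distributed (X i) X0) ->
      ('E_P[fun w => `|X0 w|%R] < +oo)%E ->
      (1 <= l <= n)%N ->
      [/\ forall s : R, 0 <= s ->
            conjugate (Mfun P X0 l) s = Mstar P X0 l s,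
          forall s : R, 0 <= s -> Mfun P X0 l s = Mexplicit P X0 l s &
          forall x : 'rV[R]_n,
            (c%:E * luxemburg_norm (Mfun P X0 l) x <=
               'E_P[fun w => (\sum_(1 <= k < l.+1)
                                kmax k (fun i => `|x ord0 i * X i w|))%R] /\
             'E_P[fun w => (\sum_(1 <= k < l.+1)
                                kmax k (fun i => `|x ord0 i * X i w|))%R] <=
               C%:E * luxemburg_norm (Mfun P X0 l) x)%E]].
Proof.
exists 4^-1, 2; split; rewrite ?invr_gt0//.
move=> d T P n X0 X l ind idd iX0 ln.
have l0 : (0 < l)%N by case/andP: ln.
split=> [s s0|s s0|x]; first exact: conjugate_MfunE.
  by rewrite MfunE// MexplicitE.
by split; [apply: luxemburg_le_expectation_sum_kmax|
  apply: expectation_sum_kmax_le_luxemburg] => // s s0; exact: MfunE.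
Qed.
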